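(* Let $X$ be a Tychonoff space. Then $C_k(X)$ is productively countably tight if, and only if, $X$ is a strongly Alster space.
   Context: $C_k(X)$ is the space of continuous real-valued functions on $X$ with the compact-open topology. For a topological space $Z$ and $z\in Z$, the tightness $t(z,Z)$ is the least cardinal $\kappa$ such that whenever $A\subset Z$ and $z\in\overline{A}$ there is $B\subset A$ with $|B|\leq\kappa$ and $z\in\overline{B}$; $t(Z)=\sup_{z\in Z}t(z,Z)$. $Z$ is productively countably tight if for every $z\in Z$, every space $Y$ with $t(Y)\leq\aleph_0$ and every $y\in Y$ one has $t((z,y),Z\times Y)\leq\aleph_0$. A family $\mathcal{C}$ of subsets of $X$ is a $K$-covering for $X$ if every compact subset of $X$ is contained in some member of $\mathcal{C}$; a $K$-subcovering is a subfamily that is itself a $K$-covering. $X$ is strongly Alster if every $K$-covering for $X$ made by $G_\delta$-sets has a countable $K$-subcovering. *)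

(* Defs.v *)
From HB Require Import structures.
From mathcomp Require Import all_boot all_order all_algebra.
From mathcomp Require Import all_classical all_reals all_analysis.
From mathcomp Require Import borel_hierarchy.
Import numFieldNormedType.Exports.

Set Implicit Arguments.
Unset Strict Implicit.
Unset Printing Implicit Defensive.

Local Open Scope classical_set_scope.
Local Open Scope card_scope.

(* [completely_regular_space] is phrased with uniformities; by
   [uniform_separatorP] it amounts to separating points from closed sets by
   continuous functions with values in [0, 1]. *)
Definition tychonoff_space (X : topologicalType) : Prop :=
  hausdorff_space X /\ completely_regular_space X.

(* The continuous functions, as a subspace of all functions X -> R with the
   compact-open topology. *)
Definition Ck (R : realType) (X : topologicalType) : topologicalType :=
  initial_topology
    ((fun f => f : X -> R) : continuousType X R -> {compact-open, X -> R}).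

(* Cardinals are represented by sets [kappa]. The property defining t(z, Z) is
   upward closed in kappa, so it holds for kappa iff the least cardinal having
   it, t(z, Z), is at most kappa; likewise t(Z), being a supremum, is at most
   kappa iff every t(z, Z) is. *)
Definition tightness_at_le (Z : topologicalType) (z : Z)
    (K : Type) (kappa : set K) : Prop :=
  forall A : set Z, closure A z ->
    exists B : set Z, [/\ B `<=` A, B #<= kappa & closure B z].

Definition tightness_le (Z : topologicalType) (K : Type) (kappa : set K) :
    Prop :=
  forall z : Z, tightness_at_le z kappa.

Definition productively_countably_tight (Z : topologicalType) : Prop :=
  forall (z : Z) (Y : topologicalType),
    tightness_le Y [set: nat] ->
    forall y : Y, tightness_at_le ((z, y) : Z * Y) [set: nat].

Definition K_covering (X : topologicalType) (C : set (set X)) : Prop :=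
  forall K : set X, compact K -> exists2 U : set X, C U & K `<=` U.

Definition strongly_Alster (X : topologicalType) : Prop :=
  forall C : set (set X), K_covering C -> (forall U, C U -> Gdelta U) ->
    exists D : set (set X), [/\ D `<=` C, countable D & K_covering D].

(* Main.v *)
(* If X is strongly Alster and (z, y) is adherent to A in C_k(X) x Y, then for
   each compact K and each n, countable tightness of Y gives a countable S in A,
   with y adherent to its second projection, whose functions are all 1/n-close
   to z on K; the points of X where they are all 1/n-close to z form a Gdelta
   containing K. For each n countably many of these Gdeltas form a K-covering,
   and the union of the corresponding sets S works.

   Conversely, write each member U of a K-covering by Gdeltas as a decreasing
   intersection of open sets G U n, and let Y be the sequential fan with one
   spine (U, n), n = 0, 1, ..., for each U. By complete regularity (0, apex) is
   adherent to the set of pairs (f, (U, n)) with f = 1 off G U n. The U that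
   occur in a countable subset still adherent to (0, apex) form a K-covering: if
   none of them contained a compact K, then K would not be contained in G U n
   for n >= n_U, and {f : |f| < 1 on K} times the neighbourhood of the apex
   given by n >= n_U would miss the countable subset. *)

Require Import Defs.
From HB Require Import structures.
From mathcomp Require Import all_boot all_order all_algebra.
From mathcomp Require Import all_classical all_reals all_analysis.
From mathcomp Require Import borel_hierarchy lra.
Import Order.TTheory GRing.Theory Num.Theory.
Import numFieldNormedType.Exports.

Set Implicit Arguments.
Unset Strict Implicit.
Unset Printing Implicit Defensive.

Local Open Scope classical_set_scope.
Local Open Scope card_scope.
Local Open Scope ring_scope.

(** * Basic neighbourhoods in the compact-open topology *)

Definition Ck_fun (R : realType) (X : topologicalType) (f : Ck R X) : X -> R :=
  (f : continuousType X R).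

Definition Ck_of (R : realType) (X : topologicalType) (f : X -> R)
    (cf : continuous f) : Ck R X :=
  HB.pack_for (continuousType X R) f (isContinuous.Build X R f cf).

Lemma Ck_fun_continuous (R : realType) (X : topologicalType) (f : Ck R X) :
  continuous (Ck_fun f).
Proof. exact: (@cts_fun _ _ (f : continuousType X R)). Qed.

Definition uniform_on (R : realType) (X : topologicalType) (z : X -> R)
    (K : set X) (e : R) : set (X -> R) :=
  [set f | forall x, K x -> `|f x - z x| < e].

(** Convergence to the continuous [z] in the compact-open topology is uniform convergence on compact
    sets; entourages of [R] are then translated into radii. *)
Lemma nbhs_CkP (R : realType) (X : topologicalType) (z : Ck R X)
    (N : set (Ck R X)) :
  nbhs z N <-> exists K e, [/\ compact K, 0 < e &
    forall f : Ck R X, uniform_on (Ck_fun z) K e (Ck_fun f) -> N f].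
Proof.
have cz := @Ck_fun_continuous _ _ z.
split.
  case=> _ [[V oV <-] Vz VN].
  (* [F] is generated by the sets on the right-hand side, so once [F] converges to [z], membership
     of [V] in [F] yields [K] and [e]. *)
  pose F : set_system (X -> R) :=
    filter_from [set Ke : set X * R | compact Ke.1 /\ 0 < Ke.2]
                (fun Ke => uniform_on (Ck_fun z) Ke.1 Ke.2).
  have FF : Filter F.
    apply: filter_from_filter.
      by exists (set0, 1) => /=; split => //; exact: compact0.
    move=> [K e] [L d] /= [cK e0] [cL d0].
    exists (K `|` L, Num.min e d) => /=.
      by split; [exact: compactU | rewrite lt_min e0 d0].
    by move=> f fz; split=> x Kx; have := fz x; rewrite lt_min => fzx;
      (have /andP[] : (`|f x - Ck_fun z x| < e) && (`|f x - Ck_fun z x| < d)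
        by apply: fzx; [left + right]).
  have Fz : {compact-open, F --> Ck_fun z}.
    apply/compact_open_fam_compactP => //.
    apply/fam_cvgP => K cK P /uniform_nbhs[E [entE EP]].
    move: entE; rewrite -entourage_ballE => -[e /= e0 eE].
    exists (K, e) => //= f fz; apply: EP => /= x Kx; apply: eE.
    by rewrite /= /ball /= distrC; exact: fz.
  have [[K e] /= [cK e0] KeV] : F V by apply: Fz; exact: open_nbhs_nbhs.
  by exists K, e; split => // f fz; apply: VN; exact: KeV.
case=> K [e [cK e0 KeN]].
pose co : {compact-open, X -> R} := Ck_fun z.
suff : nbhs co (uniform_on (Ck_fun z) K e).
  move=> nco; apply: (@filterS _ (nbhs z) _
    ((@Ck_fun R X) @^-1` uniform_on (Ck_fun z) K e)) => //.
  exact: (@initial_continuous _ _ _ z).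
have : {family compact, nbhs co --> Ck_fun z}.
  by apply/compact_open_fam_compactP.
apply; have entE : entourage [set xy : R * R | ball xy.1 e xy.2].
  by rewrite -entourage_ballE; exists e.
have := @fam_nbhs X R compact K _ (Ck_fun z) entE cK.
by apply: filterS => f fz x Kx; have := fz x Kx; rewrite /ball /= distrC.
Qed.

(** * Countable choices and countable intersections *)

Lemma countable_choice_set (T U : Type) (B : set U) (P : U -> T -> Prop) :
  B #<= [set: nat] -> (forall u, B u -> exists t, P u t) ->
  exists A : set T, [/\ countable A,
    forall u, B u -> exists2 t, A t & P u t &
    forall t, A t -> exists2 u, B u & P u t].
Proof.
move=> cB BP.
(* [None] is the value outside [B], as [T] may be empty. *)
have /choice[f fP] : forall u, exists o : option T,
    B u -> exists2 t, o = Some t & P u t.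
  move=> u.
  have [/BP[t Put]|nBu] := pselect (B u); last by exists None.
  by exists (Some t) => _; exists t.
exists [set t | exists2 u, B u & f u = Some t]; split.
- pose g (o : option T) := if o is Some t then [set t] else set0.
  have -> : [set t | exists2 u, B u & f u = Some t] = \bigcup_(u in B) g (f u).
    apply/seteqP; split=> [t [u Bu fu]|t [u Bu]].
      by exists u => //; rewrite fu.
    by rewrite /g; case fu: (f u) => [t'|] //= ->; exists u.
  apply: bigcup_countable => // u _; case: (f u) => [t|] /=.
    exact: countable1.
  exact: countable0.
- by move=> u Bu; have [t fu Put] := fP u Bu; exists t => //; exists u.
- move=> t [u Bu fu]; have [t' ft' Put] := fP u Bu.
  by exists u => //; move: Put; have [->] : Some t' = Some t by rewrite -ft'.
Qed.

Lemma countable_bigcap_Gdelta (X : topologicalType) (I : Type) (D : set I)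
    (F : I -> set X) :
  countable D -> (forall i, D i -> open (F i)) -> Gdelta (\bigcap_(i in D) F i).
Proof.
move=> /countable_injP[h hinj] oF.
(* As [h] is injective on [D], the [n]-th set is a single [F i], or the whole space when no index
   has code [n]. *)
exists (fun n => \bigcap_(i in [set i | D i /\ h i = n]) F i).
  move=> n; have [[i [Di hi]]|nD] := pselect (exists i, D i /\ h i = n).
    rewrite (_ : \bigcap_(_ in _) _ = F i); first exact: oF.
    apply/seteqP; split=> x; first by apply.
    by move=> Fx j [Dj hj]; rewrite (hinj j i) ?inE// hi.
  rewrite (_ : \bigcap_(_ in _) _ = setT); first exact: openT.
  by apply/seteqP; split=> // x _ i Hi; case: nD; exists i.
apply/seteqP; split=> x.
  by move=> FDx n _ i [Di _]; exact: FDx.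
by move=> Fx i Di; exact: (Fx (h i)).
Qed.

(** * From strongly Alster to productive countable tightness *)

Lemma strongly_Alster_Ck (R : realType) (X : topologicalType) :
  strongly_Alster X -> productively_countably_tight (Ck R X).
Proof.
move=> aX z Y tY y A clA.
have AKn (K : set X) (n : nat) : compact K ->
  exists S : set (Ck R X * Y), [/\ S `<=` A, countable S,
    forall p, S p -> uniform_on (Ck_fun z) K n.+1%:R^-1 (Ck_fun p.1) &
    closure (snd @` S) y].
  move=> cK.
  pose P (v : Y) (p : Ck R X * Y) := [/\ A p, p.2 = v &
    uniform_on (Ck_fun z) K n.+1%:R^-1 (Ck_fun p.1)].
  have cly : closure [set v | exists p, P v p] y.
    move=> V nV.
    pose N := [set f | uniform_on (Ck_fun z) K n.+1%:R^-1 (Ck_fun f)].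
    have [|[f v] [Afv [/= fz Vv]]] := clA (N `*` V).
      exists (N, V) => //; split => //.
      by apply/nbhs_CkP; exists K, n.+1%:R^-1; split.
    by exists v; split => //; exists (f, v).
  have [B [BP cB clB]] := tY y _ cly.
  have [S [cS BS SB]] := countable_choice_set cB BP.
  exists S; split => //.
  - by move=> p /SB[v _ []].
  - by move=> p /SB[v _ []].
  - apply: closure_subset clB => v /BS[p Sp [_ pv _]]; by exists p.
pose W n (S : set (Ck R X * Y)) :=
  \bigcap_(p in S) [set x | `|Ck_fun p.1 x - Ck_fun z x| < n.+1%:R^-1].
(* [good] mentions neither [n] nor [K]: closeness to [z] on [K] is recovered from the inclusion of
   [K] in [W n S]. *)
pose good : set (set (Ck R X * Y)) :=
  [set S | [/\ S `<=` A, countable S & closure (snd @` S) y]].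
have cover n : K_covering [set U | exists2 S, good S & U = W n S].
  move=> K cK; have [S [SA cS SK clS]] := AKn K n cK.
  by exists (W n S); [exists S | move=> x Kx p /SK; apply].
have Gd n U : [set U | exists2 S, good S & U = W n S] U -> Gdelta U.
  case=> S [SA cS _] ->; apply: countable_bigcap_Gdelta => // p Sp.
  have cfz : continuous (fun x => `|Ck_fun p.1 x - Ck_fun z x|).
    move=> x; apply: cvg_norm; apply: cvgB; exact: Ck_fun_continuous.
  by apply: (open_comp _ (@open_lt R n.+1%:R^-1)) => x _; exact: cfz.
have /choice[T TP] n : exists T : set (set (Ck R X * Y)),
    [/\ countable T, T `<=` good &
        forall K, compact K -> exists2 S, T S & K `<=` W n S].
  have [D [DC cD KD]] := aX _ (cover n) (Gd n).
  have [|T [cT DT TD]] := @countable_choice_set (set (Ck R X * Y)) _ D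
    (fun U S => good S /\ U = W n S) cD.
    by move=> U /DC[S gS UW]; exists S.
  exists T; split => //.
    by move=> S /TD[U _ []].
  move=> K /KD[U /DT[S TS [_ ->]] KU]; by exists S.
exists (\bigcup_n \bigcup_(S in T n) S); split.
- by move=> p [n _ [S TS Sp]]; have [_ /(_ S TS)[SA _ _] _] := TP n; exact: SA.
- apply: bigcup_countable => // n _; have [cT Tg _] := TP n.
  by apply: bigcup_countable => // S /Tg[].
- move=> Q [[N V] /= [nN nV] NVQ].
  have [K [e [cK e0 KeN]]] := (nbhs_CkP z N).1 nN.
  have [n ne] : exists n : nat, n.+1%:R^-1 < e.
    have [n _ ne] := near_infty_natSinv_lt (PosNum e0).
    by exists n; apply: (ne n); rewrite /=.
  have [_ Tg /(_ K cK)[S TS KS]] := TP n.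
  have [_ _ clS] := Tg S TS.
  (* All functions in [S] are close to [z] on [K], so only the second coordinate of [p] has to be
     controlled. *)
  have [_ [[p Sp <-] Vp]] := clS V nV.
  exists p; split; first by exists n => //; exists S.
  apply: NVQ; split => //=; apply: KeN => x Kx.
  exact: lt_trans (KS x Kx p Sp) ne.
Qed.

(** * Separation of compact sets from closed sets *)

Definition zero_one_separated (R : realType) (X : topologicalType)
    (A B : set X) : Prop :=
  exists f : X -> R, [/\ continuous f, forall x, A x -> f x = 0 &
    forall x, B x -> f x = 1].

Lemma zero_one_separatedU (R : realType) (X : topologicalType)
    (A A' B : set X) :
  zero_one_separated R A B -> zero_one_separated R A' B ->
  zero_one_separated R (A `|` A') B.
Proof.
move=> [f [cf f0 f1]] [g [cg g0 g1]]; exists (fun x => f x * g x); split.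
- by move=> x; apply: cvgM; [exact: cf | exact: cg].
- by move=> x [/f0 ->|/g0 ->]; rewrite ?mul0r ?mulr0.
- by move=> x Bx; rewrite f1// g1// mulr1.
Qed.

Lemma completely_regular_nbhs_separated (R : realType) (X : topologicalType)
    (x : X) (B : set X) :
  completely_regular_space X -> closed B -> ~ B x ->
  exists2 V, nbhs x V & zero_one_separated R V B.
Proof.
move=> crX cB nBx.
have /(@uniform_separatorP _ R)[f [cf _ f0 f1]] := crX x B cB nBx.
have fx0 : f x = 0 by apply: f0; exists x.
exists (f @^-1` [set t | t < 2^-1]).
  apply: cf; apply: open_nbhs_nbhs; split; first exact: open_lt.
  by rewrite /= fx0 invr_gt0.
(* This truncation vanishes wherever [f] is below 1/2, hence on a whole neighbourhood of [x], and
   keeps the value 1 on [B]. *)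
exists (fun u => Num.max 0 (2 * f u - 1)); split.
- move=> u; apply: (@continuous_max R X (fun=> 0) (fun u => 2 * f u - 1)).
    exact: cvg_cst.
  apply: cvgB; last exact: cvg_cst.
  by apply: cvgM; [exact: cvg_cst | exact: cf].
- by move=> u /= fu; apply/max_idPl; lra.
- move=> u Bu; have -> : f u = 1 by apply: f1; exists u.
  by rewrite (_ : 2 * 1 - 1 = 1) ?max_r//; lra.
Qed.

(** Separation from [B] holds near each point of [K] and is stable under binary unions; compactness
    makes it global. *)
Lemma completely_regular_compact_separated (R : realType)
    (X : topologicalType) (K B : set X) :
  completely_regular_space X -> compact K -> closed B -> K `&` B = set0 ->
  zero_one_separated R K B.
Proof.
move=> crX /compact_near_coveringP cK cB KB0.
(* Compactness is applied along the filter of supersets of separated sets. *)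
pose F := filter_from [set S | zero_one_separated R S B]
                      (fun S => [set S' | S `<=` S']).
have FF : Filter F.
  apply: filter_from_filter.
    by exists set0; exists (fun=> 1); split => // x; exact: cvg_cst.
  move=> S S' sS sS'; exists (S `|` S'); first exact: zero_one_separatedU.
  by move=> Q SQ; split=> x Sx; apply: SQ; [left|right].
have [|S [f [cf f0 f1]] SK] := cK _ F (fun S x => S x) FF.
  move=> x Kx.
  have nBx : ~ B x by move=> Bx; have : (K `&` B) x by []; rewrite KB0.
  have [V nV sV] := completely_regular_nbhs_separated R crX cB nBx.
  exists (V, [set S' | V `<=` S']) => /=.
    by split => //; exists V.
  by case=> u S' /= [Vu]; apply.
by exists f; split => // x Kx; apply: f0; exact: (SK S).
Qed.

(** * The sequential fan and its countable tightness *)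

(* [None] is the apex and [Some (i, n)] the n-th point of the spine i. *)
Definition sequential_fan (I : choiceType) : Type := option (I * nat).

Section sequential_fan.
Context (I : choiceType).
Local Notation fan := (sequential_fan I).

(** Points other than the apex are isolated. The rank from which a neighbourhood of the apex
    contains a spine may depend on the spine. *)
Definition fan_open : set_system fan :=
  [set O | O None -> forall i, \forall n \near \oo, O (Some (i, n))].

Lemma fan_openT : fan_open setT.
Proof. by move=> _ i; exact: filterT. Qed.

Lemma fan_openI : setI_closed fan_open.
Proof.
by move=> A B oA oB [/oA AN /oB BN] i; apply: filterS2 (AN i) (BN i) => n.
Qed.

Lemma fan_open_bigcup (J : Type) (f : J -> set fan) :
  (forall j, fan_open (f j)) -> fan_open (\bigcup_j f j).
Proof.
move=> of_ [j _ /(of_ j) fj] i; apply: filterS (fj i) => n fn; by exists j.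
Qed.

HB.instance Definition _ := Choice.on fan.
HB.instance Definition _ :=
  isOpenTopological.Build fan fan_openT fan_openI fan_open_bigcup.

Lemma nbhs_fan_apex (V : set fan) :
  nbhs (None : fan) V <->
  V None /\ forall i, \forall n \near \oo, V (Some (i, n)).
Proof.
split=> [[W [oW WN WV]]|[VN Vi]].
  by split=> [|i]; [exact: WV | apply: filterS (oW WN i) => n; exact: WV].
by exists V; split.
Qed.

Lemma nbhs_fan_isolated (p : I * nat) : nbhs (Some p : fan) [set Some p].
Proof. by exists [set Some p]; split. Qed.

(** If the apex is adherent to [A] but not in it, then [A] meets some spine infinitely often, since
    otherwise its complement would be a neighbourhood of the apex. The trace of [A] on that spine
    suffices. *)
Lemma sequential_fan_countably_tight : tightness_le fan [set: nat].
Proof.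
move=> y A clA.
have tight1 : A y -> exists B, [/\ B `<=` A, B #<= [set: nat] & closure B y].
  move=> Ay; exists [set y]; split; first by move=> _ ->.
    exact: countable1.
  exact: subset_closure.
case: y => [p|] in clA tight1 *.
  by apply: tight1; have [_ [/[swap] ->]] := clA _ (nbhs_fan_isolated p).
have [/tight1//|nAN] := pselect (A None).
have [i Ai] : exists i, ~ \forall n \near \oo, ~ A (Some (i, n)).
  apply: contrapT => /forallNP nAi.
  have [|w [Aw]] := clA (~` A); last by [].
  by apply/nbhs_fan_apex; split => // i; apply: contrapT; exact: nAi.
exists (A `&` range (fun n => Some (i, n))); split.
- by move=> ? [].
- apply: (card_le_trans (subset_card_le (@subIsetr _ _ _))).
  exact: card_image_le.
- move=> V /nbhs_fan_apex[_ /(_ i) Vi]; apply: contrapT => AV0.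
  apply: Ai; apply: filterS Vi => n Vn An; apply: AV0.
  by exists (Some (i, n)); split => //; split => //; exists n.
Qed.

End sequential_fan.

(** * From productive countable tightness to strongly Alster *)

Lemma Ck_strongly_Alster (R : realType) (X : topologicalType) :
  completely_regular_space X ->
  productively_countably_tight (Ck R X) -> strongly_Alster X.
Proof.
move=> crX tCk C covC GC.
have /choice[G GP] : forall U, exists H : nat -> set X, C U ->
    [/\ forall n, open (H n),
        forall m n, (m <= n)%N -> H n `<=` H m & U = \bigcap_n H n].
  move=> U.
  have [CU|nCU] := pselect (C U); last by exists (fun=> set0).
  have [H oH UH] := GC U CU.
  (* Partial intersections make the sequence decreasing; the bound [n.+1] includes the index [n], so
     the total intersection is unchanged. *)
  exists (fun n => \bigcap_(i in `I_n.+1) H i) => _; split.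
  - move=> n; rewrite bigcap_mkord.
    by apply: big_ind => // *; [exact: openT | exact: openI].
  - by move=> m n mn x Hx i /= im; apply: Hx => /=; exact: leq_trans im _.
  - rewrite UH; apply/seteqP; split=> x Hx n _; first by move=> i _; exact: Hx.
    by apply: (Hx n I) => /=.
have c0 : continuous ((fun=> 0) : X -> R) by move=> x; exact: cvg_cst.
pose zero : Ck R X := Ck_of c0.
pose fan : topologicalType := sequential_fan (set X).
pose A : set (Ck R X * fan) := [set p | exists U n, [/\ C U, p.2 = Some (U, n) &
  forall x, ~ G U n x -> Ck_fun p.1 x = 1]].
have clA : closure A (zero, None : fan).
  move=> Q [[N V] /= [/nbhs_CkP[K [e [cK e0 KeN]]] /nbhs_fan_apex[_ nV]] NVQ].
  have [U CU KU] := covC K cK.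
  have [oG _ UG] := GP U CU.
  have [n Vn] : exists n, V (Some (U, n)).
    by have [n _ /(_ n (leqnn n)) Vn] := nV U; exists n.
  have [|f [cf f0 f1]] := @completely_regular_compact_separated R X K (~` G U n)
      crX cK (open_closedC (oG n)).
    by apply/disjoints_subset; rewrite setCK => x /KU; rewrite {1}UG; apply.
  exists (Ck_of cf, Some (U, n)); split; first by exists U, n.
  apply: NVQ; split => //=; apply: KeN => x Kx.
  by rewrite /Ck_fun /= f0// subrr normr0.
have [B [BA cB clB]] :=
  tCk zero fan (@sequential_fan_countably_tight _) None A clA.
exists [set U | exists n f, B (f, Some (U, n))]; split.
- by move=> U [n [f /BA[U' [n' [CU' [-> _] _]]]]].
(* [set0] is a default for the apex, which no point of [B] has as second coordinate. *)
- pose g (p : Ck R X * fan) := if p.2 is Some (U, n) then U else set0.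
  apply: (sub_countable _ cB); apply: card_le_trans (card_image_le g B).
  apply: subset_card_le => U [n [f Bf]]; by exists (f, Some (U, n)).
- move=> K cK; apply: contrapT => nK.
  have nKU U : (exists n f, B (f, Some (U, n))) ->
      \forall n \near \oo, ~ (K `<=` G U n).
    move=> DU; have CU : C U by case: DU => n [f /BA[U' [n' [CU' [-> _] _]]]].
    have [_ Gdec UG] := GP U CU.
    (* Were [K] inside every [G U m], it would lie in [U]; monotonicity then extends one failure to
       all later ranks. *)
    have [m nKm] : exists m, ~ (K `<=` G U m).
      apply: contrapT => /forallNP KG; apply: nK; exists U => //.
      by rewrite UG => x Kx m _; exact: (contrapT (KG m)).
    exists m => // n /= mn KG; apply: nKm; exact: subset_trans (Gdec _ _ mn).
  (* Only the spines met by [B] are restricted: for other [U], [K] may lie in every [G U n]. *)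
  pose V : set fan := [set y | if y is Some (U, n) then
     (exists n f, B (f, Some (U, n))) -> ~ (K `<=` G U n) else True].
  have nV : nbhs (None : fan) V.
    apply/nbhs_fan_apex; split => // U.
    have [/nKU DU|nDU] := pselect (exists n f, B (f, Some (U, n))).
      by apply: filterS DU => n /= nKG _.
    by apply: nearW => n /nDU.
  pose N := [set f | uniform_on (Ck_fun zero) K 1 (Ck_fun f)].
  have nN : nbhs zero N.
    by apply/nbhs_CkP; exists K, 1; split.
  have [|[f y] [Bfy [/= fK Vy]]] := clB (N `*` V).
    by exists (N, V).
  have [U [n [_ /= yE f1]]] := BA _ Bfy.
  subst y; apply: Vy; first by exists n, f.
  (* A point of [K] outside [G U n] would give [f x = 1], against the radius 1 in [N]. *)
  move=> x Kx; apply: contrapT => /f1 fx; have := fK x Kx.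
  by rewrite fx /zero /Ck_fun /= subr0 normr1 ltxx.
Qed.

Theorem corollary4p1 (R : realType) (X : topologicalType) :
  tychonoff_space X ->
  (productively_countably_tight (Ck R X) <-> strongly_Alster X).
Proof.
move=> [_ crX]; split; first exact: Ck_strongly_Alster.
exact: strongly_Alster_Ck.
Qed.
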